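(* Let $n,p\ge 1$ be integers and let $f:\mathbb{R}^n\to\mathbb{R}$ satisfy: (i) $f$ is $p$ times continuously differentiable on $\mathbb{R}^n$; (ii) there is a constant $f_{\rm low}$ with $f(x)\ge f_{\rm low}$ for all $x\in\mathbb{R}^n$; (iii) there is a constant $L_p\ge 0$ with $\|\nabla_x^p f(x)-\nabla_x^p f(y)\|\le L_p\|x-y\|$ for all $x,y\in\mathbb{R}^n$; (iv) if $p>1$, there is a constant $\kappa_{\rm high}\le 0$ with $\min_{\|d\|\le 1}\nabla_x^i f(x)[d]^i\ge \kappa_{\rm high}$ for all $x\in\mathbb{R}^n$ and all $i\in\{2,\dots,p\}$ (set $\kappa_{\rm high}=0$ if $p=1$). Then the OFFAR$p$ algorithm requires at most $$\left[\kappa_{\rm OFFARp}\left(f(x_0)-f_{\rm low}+\frac{1}{(p+1)!}\left(\frac{L_p}{\sigma_0}\nu_{\max}+\vartheta\sigma_0\right)\right)+\left(\frac{2L_p}{\vartheta\, p!}\left(\frac{L_p}{\sigma_0}+\theta_1\right)\right)^{\frac{p+1}{p}}\right]\epsilon_1^{-\frac{p+1}{p}}+2$$ iterations and evaluations of $\{\nabla_x^i f\}_{i=1}^p$ to produce a vector $x_\epsilon\in\mathbb{R}^n$ such that $\|g(x_\epsilon)\|\le\epsilon_1$, where $$\kappa_{\rm OFFARp}=2(p+1)!\,\sigma_{\max}^{1/p}\left(\frac{1}{\vartheta\, p!}\left(\frac{L_p}{\sigma_0}+\vartheta\theta_1\right)\right)^{\frac{p+1}{p}}.$$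
   Context: Notation: $\|\cdot\|$ is the Euclidean norm on $\mathbb{R}^n$ (and the induced operator norm for tensors); $\nabla_x^i f(x)$ is the $i$th derivative tensor of $f$ at $x$, and $T[d]^i$ is the tensor $T$ applied to $i$ copies of $d$; $g(x)=\nabla_x^1 f(x)$, $g_k=g(x_k)$. The Taylor expansion is $T_{f,p}(x,s)=f(x)+\sum_{i=1}^p\frac{1}{i!}\nabla_x^i f(x)[s]^i$, $\nabla_s^1T_{f,p}$ is its gradient in $s$, and the regularized model is $m_k(s)=T_{f,p}(x_k,s)+\frac{\sigma_k}{(p+1)!}\|s\|^{p+1}$. OFFAR$p$ algorithm. Inputs: $x_0\in\mathbb{R}^n$, $\nu_0>0$, $\epsilon_1\in(0,1]$, $\theta_1>1$, $\vartheta\in(0,1]$. Set $k=0$. Step 1: evaluate $g_k$; terminate with $x_\epsilon=x_k$ if $\|g_k\|\le\epsilon_1$; else evaluate $\{\nabla_x^if(x_k)\}_{i=2}^p$. Step 2: if $k>0$, set $\mu_{1,k}=\frac{p!\,\|g_k\|}{\|s_{k-1}\|^p}-\theta_1\sigma_{k-1}$ and select $\sigma_k\in[\vartheta\nu_k,\max(\nu_k,\mu_{1,k})]$; if $k=0$, set $\sigma_0=\mu_{1,0}=\nu_0$. Then compute a step $s_k$ with $m_k(s_k)-m_k(0)<0$ and $\|\nabla_s^1T_{f,p}(x_k,s_k)\|\le\theta_1\frac{\sigma_k}{p!}\|s_k\|^p$. Step 3: set $x_{k+1}=x_k+s_k$, $\nu_{k+1}=\nu_k+\nu_k\|s_k\|^{p+1}$,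 increment $k$ by one and return to Step 1. Constants (empty sums are $0$): $$\eta=\sum_{i=2}^p\left[\frac{\max[0,-\kappa_{\rm high}](p+1)!}{i!\,\vartheta\nu_0}\right]^{\frac{1}{p-i+1}},$$ $$\kappa_1=1+2^{2p+1}\eta^{p+1}+2^{2p+1}\left[\frac{p+1}{\vartheta}\left((1+\theta_1)\frac{L_p}{\sigma_0}+\theta_1\right)\right]^{\frac{p+1}{p}},$$ $$\nu_{\max}=\max\left[\sigma_0+\sigma_0\left(2\eta+2\left(\frac{(p+1)!\,\|g_0\|}{\sigma_0}\right)^{\frac1p}\right)^{p+1},\ \frac{2\kappa_1L_p}{\vartheta}\right],$$ $$\sigma_{\max}=\max\left[\frac{2(p+1)!}{\vartheta}\left(f(x_0)-f_{\rm low}+\frac{1}{(p+1)!}\left(\frac{L_p}{\sigma_0}\nu_{\max}+\vartheta\sigma_0\right)\right)+\nu_{\max},\ L_p,\ \nu_0\right].$$ *)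

(* Defs.v *)
From mathcomp Require Import all_boot all_order all_algebra.
From mathcomp Require Import boolp classical_sets reals topology normedtype.
From mathcomp Require Import derive exp.

Set Implicit Arguments.
Unset Strict Implicit.
Unset Printing Implicit Defensive.
Import Order.TTheory GRing.Theory Num.Theory.
Import numFieldNormedType.Exports.
Local Open Scope classical_set_scope.
Local Open Scope ring_scope.

(* The library norm `|v| on 'rV[R]_n is the sup norm. It induces the same
   topology, hence the same derivatives, but every norm in the statement is the
   Euclidean one. *)
Definition enorm (R : realType) (n : nat) (v : 'rV[R]_n) : R :=
  Num.sqrt (\sum_(j < n) v 0 j ^+ 2).

(* iter_diff f [:: v1; ..; vi] x is the derivative at x in direction v1 of the
   derivative in direction v2 of ... of f, each being a Frechet derivative. *)
Fixpoint iter_diff (R : realType) (n : nat) (f : 'rV[R]_n -> R)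
    (vs : seq 'rV[R]_n) : 'rV[R]_n -> R :=
  if vs is v :: vs' then fun x => 'd (iter_diff f vs') x v else f.

(* The i-th derivative tensor of f at x, as a function of i directions; it is
   multilinear and symmetric when f is i times continuously differentiable. *)
Definition nabla (R : realType) (n : nat) (i : nat) (f : 'rV[R]_n -> R)
    (x : 'rV[R]_n) : i.-tuple 'rV[R]_n -> R :=
  fun vs => iter_diff f vs x.

(* T[d]^i *)
Definition tapply (R : realType) (n i : nat) (T : i.-tuple 'rV[R]_n -> R)
    (d : 'rV[R]_n) : R := T (nseq_tuple i d).

(* The operator norm induced by the Euclidean norm, for i-linear T. *)
Definition tnorm (R : realType) (n i : nat)
    (T : i.-tuple 'rV[R]_n -> R) : R :=
  sup [set `|T vs| | vs in
        [set vs : i.-tuple 'rV[R]_n | forall j, enorm (tnth vs j) <= 1]].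

Definition Cp (R : realType) (n p : nat) (f : 'rV[R]_n -> R) : Prop :=
  (forall vs x, (size vs < p)%N -> differentiable (iter_diff f vs) x) /\
  (forall vs, (size vs <= p)%N -> continuous (iter_diff f vs)).

Definition grad (R : realType) (n : nat) (f : 'rV[R]_n -> R) (x : 'rV[R]_n) :
  'rV[R]_n := \row_j 'd f x (delta_mx 0 j).

Definition taylor (R : realType) (n : nat) (f : 'rV[R]_n -> R) (p : nat)
    (x s : 'rV[R]_n) : R :=
  f x + \sum_(1 <= i < p.+1) (i`!%:R)^-1 * tapply (nabla (i := i) f x) s.

Definition model (R : realType) (n : nat) (f : 'rV[R]_n -> R) (p : nat)
    (sigma : R) (x s : 'rV[R]_n) : R :=
  taylor f p x s + sigma / (p.+1)`!%:R * enorm s ^+ p.+1.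

(* [offar_run] says that x, s, sigma, nu are the quantities of one execution of
   the algorithm. The algorithm stops at the first k with
   enorm (grad f (x k)) <= eps1, so the rules for iteration k (and the choice
   of sigma_k) are imposed only when it has not stopped at some j <= k; the
   entries of the sequences past the stopping index are unconstrained. The
   choices of sigma_k and s_k left open by the algorithm are left open here. *)
Definition offar_active (R : realType) (n : nat) (f : 'rV[R]_n -> R) (eps1 : R)
    (x : nat -> 'rV[R]_n) (k : nat) : Prop :=
  forall j, (j <= k)%N -> eps1 < enorm (grad f (x j)).

(* mu_{1,k+1} *)
Definition offar_muS (R : realType) (n p : nat) (f : 'rV[R]_n -> R)
    (theta1 : R) (x s : nat -> 'rV[R]_n) (sigma : nat -> R) (k : nat) : R :=
  p`!%:R * enorm (grad f (x k.+1)) / enorm (s k) ^+ p - theta1 * sigma k.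

Record offar_run (R : realType) (n p : nat) (f : 'rV[R]_n -> R)
    (x0 : 'rV[R]_n) (nu0 eps1 theta1 vtheta : R)
    (x s : nat -> 'rV[R]_n) (sigma nu : nat -> R) : Prop := OffarRun {
  run_x0 : x 0%N = x0;
  run_nu0 : nu 0%N = nu0;
  (* Not guarded by offar_active: sigma_0 occurs in the complexity bound even if
     the algorithm stops at x0. *)
  run_sigma0 : sigma 0%N = nu0;
  run_sigmaS : forall k, offar_active f eps1 x k.+1 ->
    vtheta * nu k.+1 <= sigma k.+1
      <= Num.max (nu k.+1) (offar_muS p f theta1 x s sigma k);
  run_decrease : forall k, offar_active f eps1 x k ->
    model f p (sigma k) (x k) (s k) - model f p (sigma k) (x k) 0 < 0;
  run_stationary : forall k, offar_active f eps1 x k ->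
    enorm (grad (taylor f p (x k)) (s k))
      <= theta1 * (sigma k / p`!%:R) * enorm (s k) ^+ p;
  run_xS : forall k, offar_active f eps1 x k -> x k.+1 = x k + s k;
  run_nuS : forall k, offar_active f eps1 x k ->
    nu k.+1 = nu k + nu k * enorm (s k) ^+ p.+1
}.

Definition offar_eta (R : realType) (p : nat) (kappa_high nu0 vtheta : R) : R :=
  \sum_(2 <= i < p.+1)
    (Num.max 0 (- kappa_high) * (p.+1)`!%:R / (i`!%:R * vtheta * nu0))
      `^ ((p - i).+1%:R^-1).

Definition offar_kappa1 (R : realType) (p : nat)
    (Lp kappa_high nu0 theta1 vtheta sigma0 : R) : R :=
  1 + 2 ^+ (2 * p).+1 * offar_eta p kappa_high nu0 vtheta ^+ p.+1
    + 2 ^+ (2 * p).+1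
      * (p.+1%:R / vtheta * ((1 + theta1) * (Lp / sigma0) + theta1))
          `^ (p.+1%:R / p%:R).

Definition offar_nu_max (R : realType) (n p : nat) (f : 'rV[R]_n -> R)
    (x0 : 'rV[R]_n) (Lp kappa_high nu0 theta1 vtheta sigma0 : R) : R :=
  Num.max
    (sigma0 + sigma0 *
      (2 * offar_eta p kappa_high nu0 vtheta
       + 2 * ((p.+1)`!%:R * enorm (grad f x0) / sigma0) `^ (p%:R^-1)) ^+ p.+1)
    (2 * offar_kappa1 p Lp kappa_high nu0 theta1 vtheta sigma0 * Lp / vtheta).

(* f(x_0) - f_low + 1/(p+1)! (L_p/sigma_0 nu_max + vtheta sigma_0) *)
Definition offar_gap (R : realType) (n p : nat) (f : 'rV[R]_n -> R)
    (x0 : 'rV[R]_n) (f_low Lp kappa_high nu0 theta1 vtheta sigma0 : R) : R :=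
  f x0 - f_low + (p.+1)`!%:R^-1 *
    (Lp / sigma0 * offar_nu_max p f x0 Lp kappa_high nu0 theta1 vtheta sigma0
     + vtheta * sigma0).

Definition offar_sigma_max (R : realType) (n p : nat) (f : 'rV[R]_n -> R)
    (x0 : 'rV[R]_n) (f_low Lp kappa_high nu0 theta1 vtheta sigma0 : R) : R :=
  Num.max
    (Num.max
      (2 * (p.+1)`!%:R / vtheta
         * offar_gap p f x0 f_low Lp kappa_high nu0 theta1 vtheta sigma0
       + offar_nu_max p f x0 Lp kappa_high nu0 theta1 vtheta sigma0)
      Lp)
    nu0.

Definition offar_kappa (R : realType) (n p : nat) (f : 'rV[R]_n -> R)
    (x0 : 'rV[R]_n) (f_low Lp kappa_high nu0 theta1 vtheta sigma0 : R) : R :=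
  2 * (p.+1)`!%:R
  * offar_sigma_max p f x0 f_low Lp kappa_high nu0 theta1 vtheta sigma0
      `^ (p%:R^-1)
  * ((vtheta * p`!%:R)^-1 * (Lp / sigma0 + vtheta * theta1))
      `^ (p.+1%:R / p%:R).

Definition offar_bound (R : realType) (n p : nat) (f : 'rV[R]_n -> R)
    (x0 : 'rV[R]_n)
    (f_low Lp kappa_high nu0 eps1 theta1 vtheta sigma0 : R) : R :=
  (offar_kappa p f x0 f_low Lp kappa_high nu0 theta1 vtheta sigma0
     * offar_gap p f x0 f_low Lp kappa_high nu0 theta1 vtheta sigma0
   + (2 * Lp / (vtheta * p`!%:R) * (Lp / sigma0 + theta1))
       `^ (p.+1%:R / p%:R))
  * eps1 `^ (- (p.+1%:R / p%:R)) + 2.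

(* Main.v *)
(* Write a_k = |s_k|. Taylor's theorem and the model decrease give
   f(x_{k+1}) <= f(x_k) - (sigma_k - Lp)/(p+1)! a_k^(p+1). As nu grows by
   nu_k a_k^(p+1), an increase of f at iteration k is at most
   Lp/((p+1)! nu_0) times the growth of nu. It can only occur while
   nu_k <= 2 Lp/vtheta, and nu cannot jump from there above nu_max: a step is
   bounded by a power of the current gradient norm, itself bounded by the
   previous step. Once nu_k > 2 Lp/vtheta, sigma_k >= 2 Lp and f decreases by at
   least half of the regularization term. Keeping the regularization term on
   the decrease side in both phases, the sum over all iterations of
   sigma_k a_k^(p+1)/(2 (p+1)!) is at most the gap. This bounds nu_k and sigma_k
   by sigma_max, and the gradient bound |g_{k+1}| <= (Lp + theta1 sigma_k)/p! a_k^p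
   then bounds each summand from below, so that the first term of the
   complexity bound alone dominates the number of iterations. *)
From HB Require Import structures.
Require Import Defs.
From mathcomp Require Import all_boot all_order all_algebra.
From mathcomp Require Import boolp classical_sets functions reals topology normedtype.
From mathcomp Require Import derive exp.
From mathcomp Require Import ring lra.
Import Order.TTheory GRing.Theory Num.Theory.
Import numFieldNormedType.Exports.
Local Open Scope ring_scope.

(** * Calculus along a line and a one-sided Taylor estimate *)

Lemma is_derive_line (R : realType) (n : nat) (f : 'rV[R]_n -> R)
    (x s : 'rV[R]_n) (t : R) :
  differentiable f (x + t *: s) ->
  is_derive t (1 : R) (fun u : R => f (x + u *: s)) ('d f (x + t *: s) s).
Proof.
move=> df.
have dg : is_diff t (fun u : R => x + u *: s) (fun u : R => u *: s).
  have /= := is_diffD (is_diff_cst x t) (is_diff_scalel t s).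
  by rewrite add0r.
have dfg : differentiable (fun u : R => f (x + u *: s)) t.
  by apply: differentiable_comp => //; exact: ex_diff.
apply: DeriveDef; first exact/derivable1_diffP.
rewrite deriveE //.
have -> : (fun u : R => f (x + u *: s)) = f \o (fun u : R => x + u *: s) by [].
rewrite diff_comp //=.
by rewrite [X in 'd f _ (X _)]diff_val scale1r.
Qed.

Lemma is_derive_continuous (R : realType) (f df : R -> R) :
  (forall t, is_derive t (1 : R) f (df t)) -> continuous f.
Proof.
move=> d t; apply: differentiable_continuous; apply/derivable1_diffP.
by have [] := d t.
Qed.

Lemma derive_le0_le (R : realType) (f df : R -> R) (t : R) :
  (forall u : R, is_derive u (1 : R) f (df u)) -> 0 <= t ->
  (forall u : R, 0 <= u -> df u <= 0) -> f t <= f 0.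
Proof.
move=> d t0 le0.
have [|c] := @MVT_segment R f df 0 t t0 (fun u _ => d u).
  exact/continuous_subspaceT/(is_derive_continuous _ _ _ d).
rewrite in_itv /= => /andP[c0 _] e.
by rewrite -subr_le0 e mulr_le0_ge0 ?subr0 // le0.
Qed.

(** Induction on [q] by comparing derivatives: [F 0] minus its Taylor polynomial and remainder bound
    vanishes at 0, and its derivative is the same expression for the shifted family [F i.+1],
    nonpositive by induction. No integral remainder is formed. *)
Lemma taylor_upper (R : realType) (q : nat) (F : nat -> R -> R) (C : R) (t : R) :
  (forall i (u : R), (i < q)%N -> is_derive u (1 : R) (F i) (F i.+1 u)) ->
  (forall u : R, 0 <= u -> F q u - F q 0 <= C * u) -> 0 <= t ->
  F 0%N t - \sum_(i < q.+1) F i 0 / (i`!)%:R * t ^+ i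
    <= C * t ^+ q.+1 / (q.+1)`!%:R.
Proof.
elim: q F t => [|q IH] F t d lip t0.
  by rewrite big_ord1 fact0 factS fact0 muln1 !divr1 expr0 mulr1 expr1 lip.
(* [P] is the Taylor polynomial with the remainder bound as top monomial; [Q] is its counterpart for
   the shifted family. *)
pose P := \poly_(i < q.+2) (F i 0 / i`!%:R) + (C / (q.+2)`!%:R) *: 'X^(q.+2).
pose Q := \poly_(i < q.+1) (F i.+1 0 / i`!%:R) + (C / (q.+1)`!%:R) *: 'X^(q.+1).
have PQ : P^`() = Q.
  apply/polyP => i; rewrite coef_deriv !coefD !coefZ !coef_poly !coefXn eqSS ltnS.
  have fac m : m.+1%:R / m.+1`!%:R = (m`!%:R : R)^-1.
    by rewrite factS natrM invfM mulrA divff ?mul1r ?pnatr_eq0.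
  rewrite mulrnDl -[X in X + _]mulr_natr -[X in _ + X]mulr_natr; congr (_ + _).
    by case: ifP; rewrite ?mul0r // -mulrA -[_^-1 * _]mulrC fac.
  case: eqVneq => [->|]; rewrite ?mulr0 ?mul0r // !mulr1.
  by rewrite -mulrA -[_^-1 * _]mulrC fac.
have PE u : P.[u] = \sum_(i < q.+2) F i 0 / i`!%:R * u ^+ i
    + C * u ^+ q.+2 / (q.+2)`!%:R.
  by rewrite hornerD horner_poly hornerZ hornerXn [X in _ + X]mulrAC.
have QE u : Q.[u] = \sum_(i < q.+1) F i.+1 0 / i`!%:R * u ^+ i
    + C * u ^+ q.+1 / (q.+1)`!%:R.
  by rewrite hornerD horner_poly hornerZ hornerXn [X in _ + X]mulrAC.
have dG u : is_derive u (1 : R) (F 0%N - horner P) (F 1%N u - Q.[u]).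
  by rewrite -PQ; apply: is_deriveB; exact: d.
have := @derive_le0_le R _ _ t dG t0.
rewrite !fctE !PE => le0.
rewrite -subr_le0 -addrA -opprD; apply: le_trans (le0 _) _ => [u u0|].
  by rewrite QE opprD addrA subr_le0; apply: (IH (fun i => F i.+1)) => // i v iq; exact: d.
rewrite big_ord_recl fact0 divr1 expr0 mulr1 big1 ?addr0 => [|i _].
  by rewrite expr0n mulr0 mul0r addr0 subrr.
by rewrite expr0n mulr0.
Qed.

(** * Euclidean norm and multilinear maps *)

Section EuclideanNorm.
Variables (R : realType) (n : nat).
Implicit Types u v : 'rV[R]_n.

Lemma enorm_ge0 v : 0 <= enorm v.
Proof. exact: sqrtr_ge0. Qed.

Lemma sqr_enorm v : enorm v ^+ 2 = \sum_j v 0 j ^+ 2.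
Proof. by rewrite sqr_sqrtr // sumr_ge0 // => j _; exact: sqr_ge0. Qed.

Lemma enormZ (a : R) v : enorm (a *: v) = `|a| * enorm v.
Proof.
rewrite /enorm -sqrtr_sqr -sqrtrM ?sqr_ge0 // mulr_sumr.
by congr Num.sqrt; apply: eq_bigr => j _; rewrite mxE exprMn.
Qed.

Lemma ler_enorm_coord v j : `|v 0 j| <= enorm v.
Proof.
rewrite -sqrtr_sqr ler_wsqrtr // (bigD1 j) //= lerDl.
by apply: sumr_ge0 => k _; exact: sqr_ge0.
Qed.

Lemma enorm_eq0 v : enorm v = 0 -> v = 0.
Proof.
move=> v0; apply/rowP => j; apply/eqP.
by rewrite mxE -normr_le0 -v0 ler_enorm_coord.
Qed.

Lemma enorm0 : enorm (0 : 'rV[R]_n) = 0.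
Proof. by rewrite -(scale0r 0) enormZ normr0 mul0r. Qed.

(** As [0^-1 = 0], normalising is harmless at [v = 0], and later uses need no separate zero case. *)
Lemma enorm_normalizeE v : v = enorm v *: ((enorm v)^-1 *: v).
Proof.
rewrite scalerA; have [v0|v0] := eqVneq (enorm v) 0.
  by rewrite v0 mul0r scale0r; exact: enorm_eq0.
by rewrite divff // scale1r.
Qed.

Lemma enorm_normalize_le1 v : enorm ((enorm v)^-1 *: v) <= 1.
Proof.
rewrite enormZ normfV ger0_norm ?enorm_ge0 //.
have [->|v0] := eqVneq (enorm v) 0; first by rewrite mulr0.
by rewrite mulVf.
Qed.

(** Expand the sum of the squares of [enorm v * u 0 j - enorm u * v 0 j]: it is
    [2 * (enorm u * enorm v)] times the difference of the two sides. *)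
Lemma cauchy_schwarz u v : \sum_j u 0 j * v 0 j <= enorm u * enorm v.
Proof.
have [u0|u0] := eqVneq (enorm u) 0.
  rewrite u0 (enorm_eq0 u u0) mul0r big1 // => j _; by rewrite mxE mul0r.
have [v0|v0] := eqVneq (enorm v) 0.
  rewrite v0 (enorm_eq0 v v0) mulr0 big1 // => j _; by rewrite mxE mulr0.
have up : 0 < enorm u by rewrite lt_def u0 enorm_ge0.
have vp : 0 < enorm v by rewrite lt_def v0 enorm_ge0.
have : 0 <= \sum_j (enorm v * u 0 j - enorm u * v 0 j) ^+ 2.
  by apply: sumr_ge0 => j _; exact: sqr_ge0.
have -> : \sum_j (enorm v * u 0 j - enorm u * v 0 j) ^+ 2 =
    2 * (enorm u * enorm v) * (enorm u * enorm v - \sum_j u 0 j * v 0 j).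
  rewrite (eq_bigr (fun j => enorm v ^+ 2 * u 0 j ^+ 2
    - 2 * enorm u * enorm v * (u 0 j * v 0 j) + enorm u ^+ 2 * v 0 j ^+ 2)).
    rewrite !big_split /= sumrN -!mulr_sumr -!sqr_enorm; ring.
  by move=> j _; ring.
by rewrite pmulr_rge0 ?subr_ge0 // !mulr_gt0.
Qed.

End EuclideanNorm.

(** Arguments are sequences split at an arbitrary slot, so that inductions on a prefix or on the
    length need no tuple casts. Values on sequences of another length are unconstrained. *)
Definition multilinear (R : realType) (n m : nat) (F : seq 'rV[R]_n -> R) :=
  forall us ws (a : R) v w, (size us + size ws).+1 = m ->
    F (us ++ (a *: v + w) :: ws) = a * F (us ++ v :: ws) + F (us ++ w :: ws).

Section Multilinear.
Variables (R : realType) (n : nat).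
Implicit Types (F : seq 'rV[R]_n -> R) (v s : 'rV[R]_n).

Lemma multilinear0 m F us ws : multilinear R n m F ->
  (size us + size ws).+1 = m -> F (us ++ 0 :: ws) = 0.
Proof.
move=> lF sz; have := lF us ws 1 0 0 sz.
by rewrite scaler0 add0r mul1r => /eqP; rewrite -subr_eq0 opprD addrA subrr sub0r oppr_eq0 => /eqP.
Qed.

Lemma multilinearZ m F us ws a v : multilinear R n m F ->
  (size us + size ws).+1 = m -> F (us ++ a *: v :: ws) = a * F (us ++ v :: ws).
Proof.
by move=> lF sz; rewrite -[a *: v]addr0 (lF us ws a v 0 sz) (multilinear0 m) // addr0.
Qed.

Lemma multilinear_sum_coord m F us ws v : multilinear R n m F ->
  (size us + size ws).+1 = m ->
  F (us ++ v :: ws) = \sum_j v 0 j * F (us ++ delta_mx 0 j :: ws).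
Proof.
move=> lF sz; rewrite {1}(row_sum_delta v).
elim/big_ind2: _ => [|a a' b b' <- <-|j _].
- exact: (multilinear0 m).
- by rewrite -[a']scale1r lF // mul1r scale1r.
- exact: (multilinearZ m).
Qed.

Lemma multilinear_cons m F v : multilinear R n m.+1 F ->
  multilinear R n m (fun us => F (v :: us)).
Proof.
by move=> lF us ws a w w' sz; apply: (lF (v :: us)); rewrite /= addSn sz.
Qed.

(** With [c] the norm and [u] the normalisation, this reduces bounds to unit vectors; with [c] and
    [u] constant, it is the homogeneity of [T[d]^i]. *)
Lemma multilinear_map_scale m F (c : 'rV[R]_n -> R) (u : 'rV[R]_n -> 'rV[R]_n) vs :
  multilinear R n m F -> size vs = m ->
  F [seq c v *: u v | v <- vs] = (\prod_(v <- vs) c v) * F [seq u v | v <- vs].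
Proof.
elim: vs m F => [|v vs IH] m F lF /=; first by rewrite big_nil mul1r.
case: m lF => // m lF [sz]; rewrite big_cons -mulrA.
rewrite -(IH m _ (multilinear_cons _ _ _ lF)) //.
by apply: (multilinearZ m.+1 F [::]) => //=; rewrite add0n size_map sz.
Qed.

(** Ensures that the [sup] in [tnorm] is an upper bound of its set. Expand the first slot on the
    standard basis, with coordinates at most 1 in absolute value, and induct on the other slots. *)
Lemma multilinear_bounded m F : multilinear R n m F ->
  exists C : R, forall vs, size vs = m ->
    (forall v, v \in vs -> enorm v <= 1) -> `|F vs| <= C.
Proof.
elim: m F => [|m IH] F lF; first by exists `|F [::]| => -[|].
have CP j : exists C : R, forall vs, size vs = m ->
    (forall v, v \in vs -> enorm v <= 1) -> `|F (delta_mx 0 j :: vs)| <= C.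
  exact: IH (multilinear_cons _ _ _ lF).
have [C hC] := choice CP.
exists (\sum_j C j) => -[//|v vs] [sz] bnd.
rewrite -[v :: vs]cat0s (multilinear_sum_coord m.+1) //=; last by rewrite sz.
apply: le_trans (ler_norm_sum _ _ _) _; apply: ler_sum => j _.
rewrite normrM -[leRHS]mul1r ler_pM //.
  by rewrite (le_trans (ler_enorm_coord _ _ _ _)) // bnd ?mem_head.
by apply: hC => // w wvs; rewrite bnd // in_cons wvs orbT.
Qed.

Lemma multilinear_le_tnorm m F vs : multilinear R n m F -> size vs = m ->
  `|F vs| <= tnorm (fun us : m.-tuple 'rV[R]_n => F us) * \prod_(v <- vs) enorm v.
Proof.
move=> lF sz; pose u v := (enorm v)^-1 *: v.
have uP v : v = enorm v *: u v by exact: enorm_normalizeE.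
have u1 v : enorm (u v) <= 1 by exact: enorm_normalize_le1.
rewrite -[vs in F vs]map_id (eq_map uP) (multilinear_map_scale m) //.
have prod_ge0 : 0 <= \prod_(v <- vs) enorm v by apply: prodr_ge0 => v _; exact: enorm_ge0.
rewrite normrM mulrC (ger0_norm prod_ge0) ler_wpM2r //.
have szu : size (map u vs) == m by rewrite size_map sz.
apply: ub_le_sup.
  have [C hC] := multilinear_bounded m F lF.
  exists C => _ [t /= tP <-]; apply: hC; first by rewrite size_tuple.
  by move=> v /tnthP[j ->].
exists (Tuple szu) => //= j.
by have /mapP[v _ ->] := mem_tnth j (Tuple szu).
Qed.

Lemma is_diff_coord s j : is_diff s (fun v => v 0 j) (fun v => v 0 j).
Proof.
have lin : linear (fun v : 'rV[R]_n => v 0 j : R) by move=> a u v; rewrite !mxE.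
pose lM := GRing.isLinear.Build _ _ _ _ _ lin.
pose l : {linear 'rV[R]_n -> R} := HB.pack (fun v : 'rV[R]_n => v 0 j : R) lM.
have d : forall t, differentiable l t by move=> t; exact: differentiable_coord.
have -> : (fun v : 'rV[R]_n => v 0 j : R) = l by [].
apply: DiffDef; first exact: d.
by apply: diff_lin => t; exact: differentiable_continuous.
Qed.

Lemma is_diff_sum (I : finType) (f df : I -> 'rV[R]_n -> R) s :
  (forall i, is_diff s (f i) (df i)) -> is_diff s (\sum_i f i) (\sum_i df i).
Proof.
move=> d; elim/big_ind2: _ => [|f1 g1 f2 g2 d1 d2|i _]; last exact: d.
  exact: is_diff_cst.
exact: is_diffD.
Qed.

(** Each slot is differentiated in turn. Expanding the first slot in coordinates gives a sum of
    products of a coordinate and a multilinear map with one slot fewer, to which the product rule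
    applies. *)
Lemma is_diff_multilinear m F s : multilinear R n m F ->
  is_diff s (fun v => F (nseq m v))
    (fun v => \sum_(k < m) F (nseq k s ++ v :: nseq (m - k.+1) s)).
Proof.
elim: m F => [|m IH] F lF.
  have -> : (fun v => \sum_(k < 0) F (nseq k s ++ v :: nseq (0 - k.+1) s)) = 0.
    by apply/funext => v; rewrite big_ord0.
  exact: (is_diff_cst (F [::]) s).
have expand v ws : size ws = m ->
    F (v :: ws) = \sum_j v 0 j * F (delta_mx 0 j :: ws).
  by move=> sz; apply: (multilinear_sum_coord m.+1 F [::]) => //=; rewrite sz.
have h j := is_diffM (is_diff_coord s j)
  (IH _ (multilinear_cons _ _ (delta_mx 0 j) lF)).
have := is_diff_sum _ _ _ _ h.
congr (is_diff _ _ _); apply/funext => v; rewrite fct_sumE.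
  by rewrite -[nseq m.+1 v]/(v :: nseq m v) expand ?size_nseq.
(* The term [k = 0] comes from the coordinate factor, the others from the tail. *)
rewrite big_ord_recl /= subSS subn0 expand ?size_nseq //.
rewrite big_split /= addrC; congr (_ + _).
  by apply: eq_bigr => j _; rewrite [LHS]mulrC.
under [RHS]eq_bigr => k _.
  rewrite subSS expand; first over.
  by rewrite size_cat /= !size_nseq addnS -addSn subnKC // ltn_ord.
rewrite exchange_big /=; apply: eq_bigr => j _.
by rewrite -mulr_sumr.
Qed.
End Multilinear.

(** * Symmetry of second derivatives *)

Section Schwarz.
Variables (R : realType) (n : nat) (h : 'rV[R]_n -> R).
Hypothesis dh : forall y, differentiable h y.

(** Two mean value theorems: along [a] for the difference of [h] on two lines [t *: b] apart, then
    along [b] for the derivative of [h] in direction [a]. *)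
Lemma mixed_difference (a b x : 'rV[R]_n) (t : R) : 0 <= t ->
  (forall y, differentiable (fun z => 'd h z a) y) ->
  exists c d : R, [/\ 0 <= c <= t, 0 <= d <= t &
    h (x + t *: a + t *: b) - h (x + t *: a) - (h (x + t *: b) - h x) =
    t * (t * 'd (fun z => 'd h z a) (x + (c *: a + d *: b)) b)].
Proof.
move=> t0 dda.
pose G (u : R) := h (x + t *: b + u *: a) - h (x + u *: a).
have dG u : is_derive u (1 : R) G
    ('d h (x + t *: b + u *: a) a - 'd h (x + u *: a) a).
  by apply: is_deriveB; exact: is_derive_line.
have [|c] := @MVT_segment R G _ 0 t t0 (fun u _ => dG u).
  exact/continuous_subspaceT/(is_derive_continuous _ _ _ dG).
rewrite in_itv /= => ct eG.
pose H (u : R) := 'd h (x + c *: a + u *: b) a.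
have dH u : is_derive u (1 : R) H
    ('d (fun z => 'd h z a) (x + c *: a + u *: b) b).
  exact: is_derive_line.
have [|d] := @MVT_segment R H _ 0 t t0 (fun u _ => dH u).
  exact/continuous_subspaceT/(is_derive_continuous _ _ _ dH).
rewrite in_itv /= => dt eH.
exists c, d; split => //.
move: eG; rewrite /G !scale0r !addr0 subr0 => eG.
rewrite [x + t *: a + _]addrAC eG [RHS]mulrC; congr (_ * _).
rewrite addrA [RHS]mulrC -[t in RHS]subr0 -eH /H scale0r addr0.
by rewrite addrAC.
Qed.

Lemma continuous_mixed_near (g : 'rV[R]_n -> R) (a b x : 'rV[R]_n) (e : R) :
  {for x, continuous g} -> 0 < e ->
  exists2 r : R, 0 < r & forall c d : R, 0 <= c <= r -> 0 <= d <= r ->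
    `|g (x + (c *: a + d *: b)) - g x| < e.
Proof.
move=> cg e0.
have /cvgrPdist_lt /(_ e e0) := cg.
move=> /nbhs_ballP[r /= r0 hr].
have N0 : 0 < `|a| + `|b| + 1 by rewrite ltr_wpDl // addr_ge0.
(* The added 1 keeps the denominator positive when [a = b = 0]. *)
exists (r / 2 / (`|a| + `|b| + 1)); first by rewrite !divr_gt0.
move=> c d /andP[c0 cr] /andP[d0 dr]; rewrite distrC; apply: hr.
rewrite -ball_normE /ball_ /= opprD addrA subrr add0r normrN.
apply: le_lt_trans (ler_normD _ _) _; rewrite !normrZ !ger0_norm //.
apply: (@le_lt_trans _ _ (r / 2 / (`|a| + `|b| + 1) * (`|a| + `|b| + 1))).
  rewrite !mulrDr mulr1 -[leLHS]addr0 lerD ?lerD ?ler_wpM2r // ?divr_ge0 // ?ltW //.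
by rewrite divfK ?gt_eqF // ltr_pdivrMr // ltr_pMr // ltr1n.
Qed.

Lemma eq_of_continuous_mixed (g1 g2 : 'rV[R]_n -> R) (a b x : 'rV[R]_n) :
  {for x, continuous g1} -> {for x, continuous g2} ->
  (forall t : R, 0 < t -> exists c d c' d' : R,
    [/\ 0 <= c <= t, 0 <= d <= t, 0 <= c' <= t, 0 <= d' <= t &
      g1 (x + (c *: a + d *: b)) = g2 (x + (c' *: b + d' *: a))]) ->
  g1 x = g2 x.
Proof.
move=> c1 c2 mixed.
apply/eqP; rewrite -subr_eq0 -normr_le0; apply/ler_addgt0Pl => e e0.
rewrite addr0.
have e20 : 0 < e / 2 by rewrite divr_gt0.
have [r1 r10 h1] := continuous_mixed_near _ a b x _ c1 e20.
have [r2 r20 h2] := continuous_mixed_near _ b a x _ c2 e20.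
pose t := Num.min r1 r2.
have t0 : 0 < t by rewrite lt_min r10 r20.
have [c [d [c' [d' [/andP[c0 ct] /andP[d0 dt] /andP[c0' ct'] /andP[d0' dt'] E]]]]] :=
  mixed t t0.
have tr1 : t <= r1 by rewrite ge_min lexx.
have tr2 : t <= r2 by rewrite ge_min lexx orbT.
have := h1 c d; rewrite c0 d0 !(le_trans _ tr1) // => /(_ isT isT) /ltW.
have := h2 c' d'; rewrite c0' d0' !(le_trans _ tr2) // => /(_ isT isT) /ltW.
rewrite -E -(subrKA (g1 (x + (c *: a + d *: b))) (g1 x)) => k2 k1.
by rewrite (le_trans (ler_normD _ _)) // [e]splitr lerD // distrC.
Qed.

(** The second difference of [h] over the parallelogram with sides [t *: a] and [t *: b] is
    symmetric in [a] and [b]. It is [t ^+ 2] times either mixed derivative at a point tending to [x]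
    with [t], so continuity equates the two. *)
Lemma schwarz (a b x : 'rV[R]_n) :
  (forall v y, differentiable (fun z => 'd h z v) y) ->
  (forall u v, continuous (fun y => 'd (fun z => 'd h z u) y v)) ->
  'd (fun z => 'd h z a) x b = 'd (fun z => 'd h z b) x a.
Proof.
move=> d2 c2.
apply: (eq_of_continuous_mixed (fun y => 'd (fun z => 'd h z a) y b)
  (fun y => 'd (fun z => 'd h z b) y a) a b x (c2 a b x) (c2 b a x)) => t t0.
have [c [d [c0 d0 E1]]] := mixed_difference a b x t (ltW t0) (d2 a).
have [c' [d' [c0' d0' E2]]] := mixed_difference b a x t (ltW t0) (d2 b).
exists c, d, c', d'; split => //.
have tn0 : t != 0 by rewrite gt_eqF.
apply: (mulfI tn0); apply: (mulfI tn0).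
apply: etrans (etrans _ E2); first exact: esym E1.
rewrite [x + t *: b + _]addrAC.
by rewrite !opprB [LHS]addrACA [RHS]addrACA; congr (_ + _); exact: addrC.
Qed.
End Schwarz.

(** * Derivative tensors and Taylor expansions *)

Section TaylorBounds.
Variables (R : realType) (n p : nat) (f : 'rV[R]_n -> R).
Hypothesis f_Cp : Cp p f.

(** In the outermost slot this is linearity of the differential. A prefix [us] then differentiates
    an equality of functions, where the derivatives involved have order below [p] and are
    differentiable. *)
Lemma iter_diff_multilinear m x : (m <= p)%N ->
  multilinear R n m (fun vs => iter_diff f vs x).
Proof.
move=> mp us ws a v w sz; move: mp; rewrite -{}sz.
elim: us x => [|u us IH] x mp /=; first by rewrite linearP.
have [df _] := f_Cp.
have sp z : (size (us ++ z :: ws) < p)%N by rewrite size_cat /= addnS -addSn.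
have -> : iter_diff f (us ++ (a *: v + w) :: ws) =
    a *: iter_diff f (us ++ v :: ws) + iter_diff f (us ++ w :: ws).
  by apply/funext => y; rewrite IH //= ltnW.
have dv := df _ x (sp v); have dw := df _ x (sp w).
rewrite diffD //; last exact: differentiableZ.
by rewrite diffZ.
Qed.

Lemma iter_diff_swap us ws a b : (size us + (size ws).+2 <= p)%N ->
  iter_diff f (us ++ a :: b :: ws) = iter_diff f (us ++ b :: a :: ws).
Proof.
have [df cf] := f_Cp.
elim: us => [|u us IH] sz /=; last by rewrite IH // ltnW.
rewrite add0n in sz; apply/funext => x; symmetry.
apply: (schwarz R n (iter_diff f ws)).
- by move=> y; apply: df; rewrite (leq_trans _ sz).
- by move=> v y; apply: (df (v :: ws)).
- by move=> u v; apply: (cf (v :: u :: ws)).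
Qed.

Lemma iter_diff_move_last k j s v : (k + j < p)%N ->
  iter_diff f (nseq k s ++ v :: nseq j s) = iter_diff f (nseq (k + j) s ++ [:: v]).
Proof.
elim: j k => [|j IH] k kj; first by rewrite addn0.
rewrite /= iter_diff_swap ?size_nseq ?addnS ?(leq_trans _ kj) ?addnS //.
have -> : nseq k s ++ s :: v :: nseq j s = nseq k.+1 s ++ v :: nseq j s.
  by rewrite -cat1s catA cats1 -[in RHS](addn1 k) nseqD cats1.
by rewrite IH addSnnS // addnS.
Qed.

Lemma differential_grad (g : 'rV[R]_n -> R) x v :
  'd g x v = \sum_j v 0 j * grad g x 0 j.
Proof.
rewrite {1}(row_sum_delta v) linear_sum.
by apply: eq_bigr => j _; rewrite linearZ /= mxE.
Qed.

(** By symmetry the [i.+1] slots contribute equally, which turns [1/(i+1)!] into [1/i!]. The result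
    is the Taylor polynomial of degree [p - 1] of the scalar function ['d f _ v]; keeping [v] in the
    last slot makes this visible. *)
Lemma is_diff_taylor x s :
  is_diff s (taylor f p x)
    (fun v => \sum_(i < p) iter_diff f (nseq i s ++ [:: v]) x / i`!%:R).
Proof.
have h (i : 'I_p) : is_diff s
    (fun w => (i.+1`!%:R)^-1 * iter_diff f (nseq i.+1 w) x)
    (fun v => iter_diff f (nseq i s ++ [:: v]) x / i`!%:R).
  have := is_diffZ (i.+1`!%:R)^-1 (is_diff_multilinear _ _ i.+1 _ s
    (iter_diff_multilinear i.+1 x (ltn_ord i))).
  congr (is_diff _ _ _); apply/funext => v /=.
  transitivity ((i.+1`!%:R)^-1 *
      \sum_(k < i.+1) iter_diff f (nseq i s ++ [:: v]) x).
    congr (_ * _); apply: eq_bigr => k _.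
    by rewrite subSS iter_diff_move_last subnKC ?leq_ord.
  rewrite sumr_const card_ord -[iter_diff _ _ _ *+ _]mulr_natl mulrA [RHS]mulrC; congr (_ * _).
  by rewrite factS natrM invfM mulrAC mulVf ?mul1r // pnatr_eq0.
have := is_diffD (is_diff_cst (f x) s) (is_diff_sum _ _ _ _ _ s h).
congr (is_diff _ _ _); apply/funext => v; rewrite ?add0r !fct_sumE //.
by rewrite /taylor big_add1 /= big_mkord.
Qed.

Variable Lp : R.
Hypothesis Lp_ge0 : 0 <= Lp.
Hypothesis f_Lipschitz : forall y z : 'rV[R]_n,
  tnorm (fun vs : p.-tuple 'rV[R]_n => nabla f y vs - nabla f z vs)
    <= Lp * enorm (y - z).

(** The difference of two tensors is again multilinear, hence controlled by its [tnorm]. The base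
    point stays [x + 0 *: s] to match [F q 0] in [taylor_upper]. *)
Lemma iter_diff_lipschitz vs x s t : size vs = p -> 0 <= t ->
  iter_diff f vs (x + t *: s) - iter_diff f vs (x + 0 *: s)
    <= Lp * enorm s * (\prod_(v <- vs) enorm v) * t.
Proof.
move=> sz t0; apply: le_trans (ler_norm _) _.
pose F us := iter_diff f us (x + t *: s) - iter_diff f us (x + 0 *: s).
have lF : multilinear R n p F.
  move=> us ws a v w szp; rewrite /F !(iter_diff_multilinear p) //.
  by rewrite mulrBr opprD addrACA.
apply: le_trans (multilinear_le_tnorm R n p F vs lF sz) _.
rewrite [leRHS]mulrAC ler_wpM2r //.
  by apply: prodr_ge0 => v _; exact: enorm_ge0.
apply: le_trans (f_Lipschitz (x + t *: s) (x + 0 *: s)) _.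
by rewrite scale0r addr0 addrAC subrr add0r enormZ ger0_norm // mulrAC mulrA.
Qed.

Lemma taylor_value_bound x s :
  f (x + s) - taylor f p x s <= Lp * enorm s ^+ p.+1 / p.+1`!%:R.
Proof.
have [df _] := f_Cp.
pose F i t := iter_diff f (nseq i s) (x + t *: s).
have -> : f (x + s) - taylor f p x s =
    F 0%N 1 - \sum_(i < p.+1) F i 0 / i`!%:R * 1 ^+ i.
  rewrite /F scale1r /= big_ord_recl /= fact0 divr1 expr0 mulr1 scale0r addr0.
  rewrite /taylor big_add1 /= big_mkord; congr (_ - (_ + _)).
  by apply: eq_bigr => i _; rewrite expr1n mulr1 mulrC.
rewrite -[_ ^+ p.+1]mulr1 mulrA -[X in _ * X / _](expr1n _ p.+1).
apply: taylor_upper => //.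
- by move=> i u ip; apply: is_derive_line; apply: df; rewrite size_nseq.
- move=> u u0; have := iter_diff_lipschitz (nseq p s) x s u.
  rewrite size_nseq big_nseq iter_mulr_1 -(mulrA Lp) -exprS => /(_ erefl u0).
  by [].
Qed.

(** The scalar estimate of order [p - 1] for the derivative along a fixed [v], which replaces a
    vector-valued Taylor formula; a norm bound results from a suitable choice of [v]. *)
Lemma taylor_gradient_bound (x s v : 'rV[R]_n) : (0 < p)%N ->
  \sum_j v 0 j * grad f (x + s) 0 j
    - \sum_j v 0 j * grad (taylor f p x) s 0 j
    <= Lp * enorm s ^+ p * enorm v / p`!%:R.
Proof.
have [df _] := f_Cp.
move=> p0; pose F i t := iter_diff f (nseq i s ++ [:: v]) (x + t *: s).
have e1 : \sum_j v 0 j * grad f (x + s) 0 j <= F 0%N 1.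
  by rewrite -differential_grad /F scale1r; exact: lexx.
have e2 : \sum_(i < p.-1.+1) F i 0 / i`!%:R * 1 ^+ i
    <= \sum_j v 0 j * grad (taylor f p x) s 0 j.
  rewrite -differential_grad (prednK p0) (@diff_val _ _ _ _ _ _ _ (is_diff_taylor x s)).
  by apply: ler_sum => i _; rewrite /F scale0r addr0 expr1n mulr1.
apply: le_trans (lerB e1 e2) _.
have := @taylor_upper R p.-1 F (Lp * enorm s ^+ p * enorm v) 1.
rewrite expr1n mulr1 (prednK p0); apply => //.
- move=> i u ip; apply: is_derive_line; apply: df.
  by rewrite size_cat size_nseq addn1 -[ltnRHS](prednK p0) ltnS.
- move=> u u0; have := iter_diff_lipschitz (nseq p.-1 s ++ [:: v]) x s u.
  rewrite size_cat size_nseq addn1 prednK // big_cat big_nseq big_seq1.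
  rewrite iter_mulr_1 /=.
  have -> : enorm s ^+ p = enorm s * enorm s ^+ p.-1 by rewrite -exprS prednK.
  rewrite !mulrA => /(_ erefl u0).
  by [].
Qed.

(** Turns an estimate tested in the direction [g] itself into one on norms: bound the product of [g]
    and [h] by Cauchy-Schwarz and cancel a factor [enorm g]. *)
Lemma enorm_le_of_dot (g h : 'rV[R]_n) (B : R) : 0 <= B ->
  \sum_j g 0 j * g 0 j - \sum_j g 0 j * h 0 j <= B * enorm g ->
  enorm g <= B + enorm h.
Proof.
move=> B0; have [->|g0] := eqVneq (enorm g) 0.
  by move=> _; rewrite addr_ge0 ?enorm_ge0.
have gp : 0 < enorm g by rewrite lt_def g0 enorm_ge0.
have -> : \sum_j g 0 j * g 0 j = enorm g * enorm g.
  by rewrite -expr2 sqr_enorm; apply: eq_bigr => j _; rewrite expr2.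
rewrite lerBlDr => le; rewrite -(ler_pM2r gp); apply: le_trans le _.
by rewrite mulrDl lerD2l mulrC cauchy_schwarz // mulrC.
Qed.

Lemma enorm_grad_step_le x s : (0 < p)%N ->
  enorm (grad f (x + s))
    <= Lp * enorm s ^+ p / p`!%:R + enorm (grad (taylor f p x) s).
Proof.
move=> p0; apply: enorm_le_of_dot.
  by rewrite !mulr_ge0 ?exprn_ge0 ?enorm_ge0 // invr_ge0 ler0n.
have := taylor_gradient_bound x s (grad f (x + s)) p0.
by rewrite [leRHS]mulrAC.
Qed.

(** Cauchy-Schwarz handles the linear term; homogeneity carries the lower bound [kappa] from the
    unit ball to [s] in each higher degree. Against the model decrease this limits the step
    length. *)
Lemma taylor_decrease_le (kappa : R) x s : (0 < p)%N ->
  (forall i, (2 <= i <= p)%N -> forall d, enorm d <= 1 ->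
     kappa <= tapply (nabla (i := i) f x) d) ->
  f x - taylor f p x s <= enorm (grad f x) * enorm s
    + \sum_(2 <= i < p.+1) Num.max 0 (- kappa) / i`!%:R * enorm s ^+ i.
Proof.
move=> p0 high.
rewrite /taylor opprD addrA subrr add0r big_ltn ?ltnS // opprD; apply: lerD.
  rewrite factS fact0 invr1 mul1r /tapply /nabla /= differential_grad.
  have := cauchy_schwarz _ _ (- s) (grad f x).
  rewrite -scaleN1r enormZ normrN1 mul1r mulrC; apply: le_trans.
  rewrite -sumrN ler_sum // => j _; rewrite scaleN1r.
  by have -> : (- s) 0 j = - s 0 j; rewrite ?mxE // mulNr.
rewrite -sumrN big_nat [leRHS]big_nat; apply: ler_sum => i ip.
rewrite mulrC -mulNr -[leRHS]mulrAC ler_wpM2r ?invr_ge0 ?ler0n //.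
pose u := (enorm s)^-1 *: s.
have us : s = enorm s *: u by exact: enorm_normalizeE.
have u1 : enorm u <= 1 by exact: enorm_normalize_le1.
have -> : tapply (nabla (i := i) f x) s = enorm s ^+ i * tapply (nabla (i := i) f x) u.
  rewrite /tapply /nabla /=.
  have := multilinear_map_scale R n i (fun vs => iter_diff f vs x) (fun=> enorm s)
    (fun=> u) (nseq i s).
  rewrite big_nseq iter_mulr_1 !map_nseq -us size_nseq; apply => //.
  by apply: iter_diff_multilinear; case/andP: ip.
rewrite mulrC -mulNr ler_wpM2r ?exprn_ge0 ?enorm_ge0 //.
by rewrite le_max lerN2 high // orbT.
Qed.

End TaylorBounds.

(** * Complexity of the recursion *)

Lemma exprD_le_convex (R : realType) (m : nat) (x y : R) : 0 <= x -> 0 <= y ->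
  (x + y) ^+ m.+1 <= 2 ^+ m * (x ^+ m.+1 + y ^+ m.+1).
Proof.
move=> x0 y0; elim: m => [|m IH]; first by rewrite expr0 mul1r !expr1.
rewrite exprS; apply: le_trans (ler_wpM2l (addr_ge0 x0 y0) IH) _.
rewrite mulrCA (exprSr 2 m) -mulrA ler_wpM2l ?exprn_ge0 //.
set X := x ^+ m.+1; set Y := y ^+ m.+1.
(* The powers are ordered like [x] and [y], so [x * Y + y * X] is at most [x * X + y * Y]. *)
have : 0 <= (x - y) * (X - Y).
  have [xy|yx] := leP x y.
    by rewrite mulr_le0 // subr_le0 // lerXn2r.
  by rewrite mulr_ge0 // subr_ge0 ?lerXn2r // ltW.
by rewrite [x ^+ m.+2]exprS [y ^+ m.+2]exprS -/X -/Y; nra.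
Qed.

(* Fujiwara's bound on the positive solutions of a polynomial inequality. *)
Lemma positive_root_bound (R : realType) (p : nat) (c : nat -> R) (a sigma : R) :
  0 < a -> 0 < sigma -> (forall i, 0 <= c i) ->
  sigma * a ^+ p.+1 <= \sum_(1 <= i < p.+1) c i * a ^+ i ->
  a <= 2 * \sum_(1 <= i < p.+1) (c i / sigma) `^ ((p - i).+1%:R^-1).
Proof.
move=> a0 s0 c0 le; rewrite leNgt; apply/negP => gt.
set r := \sum_(1 <= i < p.+1) _ in gt.
(* As [a] exceeds [2 * r], each term is at most [sigma * a ^+ p.+1] times a power of 1/2; these
   powers sum to less than 1, a contradiction. *)
have le2 : \sum_(1 <= i < p.+1) c i * a ^+ i <=
    \sum_(1 <= i < p.+1) sigma * a ^+ p.+1 * 2^-1 ^+ (p - i).+1.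
  rewrite big_nat [leRHS]big_nat; apply: ler_sum => i /andP[i1 ip].
  rewrite ltnS in ip.
  have ri : (c i / sigma) `^ ((p - i).+1%:R^-1) <= r.
    rewrite /r (bigD1_seq i) ?iota_uniq //=; last by rewrite mem_index_iota i1 ltnS.
    by rewrite lerDl sumr_ge0 // => j _; exact: powR_ge0.
  have ra : (c i / sigma) `^ ((p - i).+1%:R^-1) <= 2^-1 * a.
    apply: le_trans ri _; rewrite ler_pdivlMl // ltW //.
  have e : c i / sigma = ((c i / sigma) `^ ((p - i).+1%:R^-1)) ^+ (p - i).+1.
    rewrite -powR_mulrn ?powR_ge0 // -powRrM mulVf ?pnatr_eq0 // powRr1 //.
    by rewrite divr_ge0 // ltW.
  have -> : c i = sigma * (c i / sigma) by rewrite mulrC divfK ?gt_eqF.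
  rewrite -[leLHS]mulrA -[leRHS]mulrA ler_wpM2l ?(ltW s0) // e.
  apply: (@le_trans _ _ ((2^-1 * a) ^+ (p - i).+1 * a ^+ i)).
    rewrite ler_wpM2r ?exprn_ge0 ?(ltW a0) // lerXn2r ?nnegrE ?powR_ge0 //.
    by rewrite mulr_ge0 ?invr_ge0 ?(ltW a0).
  by rewrite exprMn -mulrA -exprD addSn subnK // mulrC.
have geo m : \sum_(1 <= i < m.+1) (2^-1 : R) ^+ (m - i).+1 < 1.
  rewrite (_ : \sum_(_ <= _ < _) _ = 1 - 2^-1 ^+ m).
    by rewrite ltrBlDr ltrDl exprn_gt0 // invr_gt0.
  elim: m => [|m IH]; first by rewrite big_geq // expr0 subrr.
  rewrite big_nat_recr //= subnn expr1.
  rewrite (eq_big_nat _ _ (F2 := fun i => 2^-1 * 2^-1 ^+ (m - i).+1)).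
    by rewrite -mulr_sumr IH exprS; lra.
  by move=> i /andP[_ im]; rewrite -exprS subSn.
have := le_trans le le2; rewrite -mulr_sumr.
have A0 : 0 < sigma * a ^+ p.+1 by rewrite mulr_gt0 ?exprn_gt0.
by rewrite -[leLHS]mulr1 ler_pM2l // leNgt geo.
Qed.

(** In the root bound, the coefficient of degree 1 yields the gradient term; the radicals of the
    higher ones are dominated by those in [offar_eta] because [sigma] is at least [vtheta * nu0]. *)
Lemma offar_step_le (R : realType) (p : nat) (kappa nu0 vtheta sigma g a : R) :
  (0 < p)%N -> 0 < a -> 0 < nu0 -> 0 < vtheta -> vtheta * nu0 <= sigma -> 0 <= g ->
  sigma / p.+1`!%:R * a ^+ p.+1 <=
    g * a + \sum_(2 <= i < p.+1) Num.max 0 (- kappa) / i`!%:R * a ^+ i ->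
  a <= 2 * offar_eta p kappa nu0 vtheta + 2 * (p.+1`!%:R * g / sigma) `^ (p%:R^-1).
Proof.
move=> p0 a0 n0 v0 vs g0 le.
have vn0 : 0 < vtheta * nu0 by rewrite mulr_gt0.
have s0 : 0 < sigma := lt_le_trans vn0 vs.
have fp m : 0 < m`!%:R :> R by rewrite ltr0n fact_gt0.
have m0 : 0 <= Num.max 0 (- kappa) by rewrite le_max lexx.
pose c i := p.+1`!%:R * (if i == 1%N then g else Num.max 0 (- kappa) / i`!%:R).
have c0 i : 0 <= c i.
  by rewrite mulr_ge0 ?(ltW (fp _)) //; case: ifP => // _; rewrite divr_ge0 ?(ltW (fp _)).
have := positive_root_bound R p c a sigma a0 s0 c0.
have -> : \sum_(1 <= i < p.+1) c i * a ^+ i = p.+1`!%:R * (g * a +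
    \sum_(2 <= i < p.+1) Num.max 0 (- kappa) / i`!%:R * a ^+ i).
  rewrite big_ltn ?ltnS // mulrDr mulr_sumr /c eqxx mulrA; congr (_ + _).
  by rewrite big_nat [RHS]big_nat; apply: eq_bigr => -[|[|i]] //= _; rewrite -mulrA.
rewrite -ler_pdivrMl // mulrA [_^-1 * _]mulrC => /(_ le) bnd.
apply: le_trans bnd _; rewrite -mulrDr ler_pM2l //.
rewrite big_ltn ?ltnS // /c eqxx subn1 prednK // addrC lerD2r.
rewrite /offar_eta big_nat [leRHS]big_nat; apply: ler_sum => -[|[|i]] //= _.
rewrite ge0_ler_powR ?invr_ge0 ?ler0n ?nnegrE //.
- by rewrite !mulr_ge0 ?invr_ge0 ?(ltW (fp _)) ?(ltW s0).
- by rewrite !mulr_ge0 ?invr_ge0 ?mulr_ge0 ?(ltW (fp _)) ?(ltW v0) ?(ltW n0).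
rewrite mulrA [_ * Num.max _ _]mulrC -mulrA -invfM ler_wpM2l //.
  by rewrite mulr_ge0 ?(ltW (fp _)).
by rewrite lef_pV2 ?posrE ?mulr_gt0 // -mulrA ler_pM2l.
Qed.

(* [a] is a step length, [g'] a gradient norm, and primes mark the next
   iteration. *)
Lemma offar_nu_growth (R : realType) (p : nat) (Lp kappa nu0 theta1 vtheta : R)
    (sigma0 nu sigma nu' sigma' a a' g' : R) :
  (0 < p)%N -> 0 <= Lp -> 0 < theta1 -> 0 < vtheta -> 0 < sigma0 -> 0 < nu0 ->
  sigma0 <= nu -> 0 < sigma -> 0 <= a -> 0 <= a' -> 0 <= g' ->
  sigma <= Num.max nu Lp -> nu' = nu + nu * a ^+ p.+1 -> vtheta * nu' <= sigma' ->
  p`!%:R * g' <= (Lp + theta1 * sigma) * a ^+ p ->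
  a' <= 2 * offar_eta p kappa nu0 vtheta
        + 2 * (p.+1`!%:R * g' / sigma') `^ (p%:R^-1) ->
  nu' + nu' * a' ^+ p.+1 <=
    offar_kappa1 p Lp kappa nu0 theta1 vtheta sigma0 * nu'.
Proof.
move=> p0 L0 th0 v0 s00 n00 nu_ge s0 a0 a'0 g'0 s_le nu'E s'_ge g'_le a'_le.
have nu_gt0 : 0 < nu := lt_le_trans s00 nu_ge.
have nu_le : nu <= nu' by rewrite nu'E lerDl mulr_ge0 ?exprn_ge0 // ltW.
have nu'_gt0 : 0 < nu' := lt_le_trans nu_gt0 nu_le.
have s'0 : 0 < sigma' by apply: lt_le_trans s'_ge; rewrite mulr_gt0.
have eta0 : 0 <= offar_eta p kappa nu0 vtheta.
  by apply: sumr_ge0 => i _; exact: powR_ge0.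
set eta := offar_eta _ _ _ _ in a'_le eta0 *.
set r := _ `^ _ in a'_le.
have r0 : 0 <= r by exact: powR_ge0.
pose Q := p.+1%:R / vtheta * ((1 + theta1) * (Lp / sigma0) + theta1).
have Q0 : 0 <= Q.
  rewrite mulr_ge0 ?divr_ge0 ?ler0n ?(ltW v0) // addr_ge0 ?(ltW th0) //.
  by rewrite mulr_ge0 ?addr_ge0 ?ler01 ?(ltW th0) ?divr_ge0 // ltW.
have p0R : 0 < p%:R :> R by rewrite ltr0n.
have pn0 : p%:R != 0 :> R by rewrite gt_eqF.
have nn0 : 0 <= nu / nu' by rewrite divr_ge0 // ltW.
(* The ratio [nu / nu'] is kept: multiplied by the outer [nu'] it leaves [nu * a ^+ p.+1], which is
   at most [nu']. *)
have rp : p.+1`!%:R * g' / sigma' <= Q * (nu / nu') * a ^+ p.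
  have lin : Lp + theta1 * sigma <= ((1 + theta1) * (Lp / sigma0) + theta1) * nu.
    have LL : Lp <= Lp / sigma0 * nu.
      by rewrite mulrAC ler_pdivlMr // ler_wpM2l.
    have sL : sigma <= nu + Lp.
      apply: le_trans s_le _; rewrite ge_max lerDl L0 lerDr; exact: ltW.
    have := ler_wpM2l (ltW th0) sL; nra.
  rewrite ler_pdivrMr // factS natrM -mulrA.
  apply: (@le_trans _ _ (p.+1%:R * (((1 + theta1) * (Lp / sigma0) + theta1) * nu * a ^+ p))).
    rewrite ler_wpM2l // (le_trans g'_le) // ler_wpM2r ?exprn_ge0 //.
  apply: (@le_trans _ _ (Q * (nu / nu') * a ^+ p * (vtheta * nu'))).
    rewrite /Q le_eqVlt; apply/orP; left; apply/eqP; field.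
    by rewrite !gt_eqF.
  by rewrite ler_wpM2l // mulr_ge0 ?exprn_ge0 // mulr_ge0.
have rP : r ^+ p.+1 <= Q `^ (p.+1%:R / p%:R) * (nu / nu') * a ^+ p.+1.
  have nn1 : nu / nu' <= 1 by rewrite ler_pdivrMr ?mul1r.
  rewrite -powR_mulrn // /r -powRrM [_^-1 * _]mulrC.
  apply: le_trans (ge0_ler_powR _ _ _ rp) _; rewrite ?nnegrE.
  - by rewrite divr_ge0 ?ler0n.
  - by rewrite mulr_ge0 ?invr_ge0 ?(ltW s'0) // mulr_ge0 ?ler0n.
  - by rewrite mulr_ge0 ?exprn_ge0 // mulr_ge0.
  rewrite (powRM _ (mulr_ge0 Q0 nn0) (exprn_ge0 _ a0)) (powRM _ Q0 nn0).
  have -> : (a ^+ p) `^ (p.+1%:R / p%:R) = a ^+ p.+1.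
    by rewrite -powR_mulrn // -powRrM mulrC divfK // powR_mulrn.
  rewrite ler_wpM2r ?exprn_ge0 // ler_wpM2l ?powR_ge0 //.
  (* A number in [(0, 1]] only decreases under an exponent at least 1. *)
  apply: ge1r_powR; first by rewrite divr_gt0.
  by rewrite ler_pdivlMr // mul1r ler_nat.
(* The constant is [2 ^+ p.+1] from the step bound times [2 ^+ p] from convexity. *)
have a'P : a' ^+ p.+1 <= 2 ^+ (2 * p).+1 * (eta ^+ p.+1 + r ^+ p.+1).
  have e2 : 2 * eta + 2 * r = 2 * (eta + r) by rewrite mulrDr.
  rewrite e2 in a'_le.
  apply: (@le_trans _ _ ((2 * (eta + r)) ^+ p.+1)).
    by rewrite lerXn2r ?nnegrE // mulr_ge0 ?addr_ge0.
  rewrite exprMn; apply: le_trans (ler_wpM2l _ (exprD_le_convex _ _ _ _ eta0 r0)) _.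
    by rewrite exprn_ge0.
  by rewrite mulrA -exprD addSn mul2n addnn.
have nua : nu * a ^+ p.+1 <= nu' by rewrite nu'E lerDr ltW.
rewrite /offar_kappa1 -/eta -/Q -addrA mulrDl mul1r lerD2l.
apply: le_trans (ler_wpM2l (ltW nu'_gt0) a'P) _.
rewrite mulrC -mulrDr -!mulrA ler_wpM2l ?exprn_ge0 // !mulrDl lerD2l.
apply: le_trans (ler_wpM2r (ltW nu'_gt0) rP) _.
rewrite -!mulrA ler_wpM2l ?powR_ge0 //.
by rewrite [nu'^-1 * _]mulrC mulfK ?gt_eqF.
Qed.

(** * Counting iterations from scalar inequalities *)

Section Counting.
Variables (R : realType) (p : nat) (Lp kappa nu0 theta1 vtheta f_low eps : R).
Variables (F a g sigma nu : nat -> R) (M : nat).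
Hypotheses (p_gt0 : (0 < p)%N) (Lp_ge0 : 0 <= Lp) (nu0_gt0 : 0 < nu0).
Hypotheses (theta1_gt0 : 0 < theta1) (vtheta_gt0 : 0 < vtheta) (vtheta_le1 : vtheta <= 1).
Hypothesis eps_gt0 : 0 < eps.
Hypotheses (nuO : nu 0 = nu0) (sigmaO : sigma 0 = nu0).
Hypothesis f_low_le : forall k, f_low <= F k.
Hypothesis g_gt : forall k, (k <= M)%N -> eps < g k.
Hypothesis a_gt0 : forall k, (k <= M)%N -> 0 < a k.
Hypothesis nuS : forall k, (k <= M)%N -> nu k.+1 = nu k + nu k * a k ^+ p.+1.
Hypothesis sigmaS : forall k, (k < M)%N ->
  vtheta * nu k.+1 <= sigma k.+1 <= Num.max (nu k.+1) Lp.
Hypothesis decrease : forall k, (k <= M)%N ->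
  F k.+1 <= F k - (sigma k - Lp) / p.+1`!%:R * a k ^+ p.+1.
Hypothesis grad_le : forall k, (k < M)%N ->
  p`!%:R * g k.+1 <= (Lp + theta1 * sigma k) * a k ^+ p.
Hypothesis step_le : forall k, (k <= M)%N -> vtheta * nu0 <= sigma k ->
  a k <= 2 * offar_eta p kappa nu0 vtheta
         + 2 * (p.+1`!%:R * g k / sigma k) `^ (p%:R^-1).

Variables (nu_max gap sigma_max : R).
Hypothesis nu_max_first : nu0 + nu0 * (2 * offar_eta p kappa nu0 vtheta
  + 2 * (p.+1`!%:R * g 0 / nu0) `^ (p%:R^-1)) ^+ p.+1 <= nu_max.
Hypothesis nu_max_later :
  2 * offar_kappa1 p Lp kappa nu0 theta1 vtheta nu0 * Lp / vtheta <= nu_max.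
Hypothesis gap_ge :
  F 0%N - f_low + p.+1`!%:R^-1 * (Lp / nu0 * nu_max + vtheta * nu0) <= gap.
Hypothesis sigma_max_gap : 2 * p.+1`!%:R / vtheta * gap + nu_max <= sigma_max.
Hypothesis sigma_max_Lp : Lp <= sigma_max.

Let fact_gt0R m : 0 < m`!%:R :> R.
Proof. by rewrite ltr0n fact_gt0. Qed.

Let a_ge0 k : (k <= M)%N -> 0 <= a k.
Proof. by move=> kM; rewrite ltW ?a_gt0. Qed.

Lemma offar_nu_ge k : (k <= M.+1)%N -> nu0 <= nu k.
Proof.
elim: k => [|k IH] kM; first by rewrite nuO.
have nk := IH (ltnW kM).
by rewrite nuS // (le_trans nk) // lerDl mulr_ge0 ?exprn_ge0 ?a_ge0 // (le_trans _ nk) ?ltW.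
Qed.

Lemma offar_nu_gt0 k : (k <= M.+1)%N -> 0 < nu k.
Proof. by move=> kM; exact: lt_le_trans (offar_nu_ge k kM). Qed.

Lemma offar_sigma_range k : (k <= M)%N ->
  vtheta * nu k <= sigma k <= Num.max (nu k) Lp.
Proof.
case: k => [_|k]; last exact: sigmaS.
by rewrite nuO sigmaO le_max lexx ler_piMl // ltW.
Qed.

Lemma offar_sigma_ge k : (k <= M)%N -> vtheta * nu0 <= sigma k.
Proof.
move=> kM; have /andP[+ _] := offar_sigma_range k kM; apply: le_trans.
by rewrite ler_pM2l // offar_nu_ge // ltnW.
Qed.

Lemma offar_sigma_gt0 k : (k <= M)%N -> 0 < sigma k.
Proof. by move=> kM; apply: lt_le_trans (offar_sigma_ge k kM); rewrite mulr_gt0. Qed.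

(** At [k = 0] the initial gradient controls the step, whence the first entry of the maximum
    defining [nu_max]. Later, [offar_nu_growth] multiplies [nu k], still at most [2 * Lp / vtheta],
    by at most [offar_kappa1]. *)
Lemma offar_nuS_le_max k : (k <= M)%N -> nu k <= 2 * Lp / vtheta ->
  nu k.+1 <= nu_max.
Proof.
case: k => [|k] kM small.
  apply: le_trans nu_max_first; rewrite nuS // nuO lerD2l ler_pM2l //.
  have := step_le 0 kM (offar_sigma_ge 0 kM); rewrite sigmaO => le.
  by rewrite lerXn2r ?nnegrE ?a_ge0 // (le_trans (a_ge0 0 kM)).
have kM' := ltnW kM.
have /andP[_ s_le] := offar_sigma_range k kM'.
have /andP[s'_ge _] := offar_sigma_range k.+1 kM.
rewrite nuS //; apply: le_trans nu_max_later.
have g0 : 0 <= g k.+1 by rewrite ltW // (lt_trans eps_gt0) ?g_gt.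
apply: le_trans (offar_nu_growth R p Lp kappa nu0 theta1 vtheta nu0 _ _ _ _ _ _ _
  p_gt0 Lp_ge0 theta1_gt0 vtheta_gt0 nu0_gt0 nu0_gt0 (offar_nu_ge k (leqW kM'))
  (offar_sigma_gt0 k kM') (a_ge0 k kM') (a_ge0 _ kM) g0 s_le (nuS k kM') s'_ge
  (grad_le k kM) (step_le _ kM (offar_sigma_ge _ kM))) _.
have k1 : 0 <= offar_kappa1 p Lp kappa nu0 theta1 vtheta nu0.
  rewrite !addr_ge0 ?mulr_ge0 ?exprn_ge0 ?powR_ge0 //.
  by apply: sumr_ge0 => i _; exact: powR_ge0.
apply: le_trans (ler_wpM2l k1 small) _.
by rewrite !mulrA [_ * 2]mulrC.
Qed.

Lemma offar_nu_max_ge : nu0 <= nu_max.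
Proof.
apply: le_trans nu_max_first; rewrite lerDl mulr_ge0 ?(ltW nu0_gt0) // exprn_ge0 //.
rewrite addr_ge0 ?mulr_ge0 ?powR_ge0 //.
by apply: sumr_ge0 => i _; exact: powR_ge0.
Qed.

(* While [nu k <= 2 Lp / vtheta] an increase of [F] is paid for by the growth of
   [nu], which stays below [nu_max]; afterwards [sigma k >= 2 Lp] and [F]
   decreases by half of the regularization term. *)
Lemma offar_potential k : (k <= M.+1)%N ->
  \sum_(j < k) sigma j / (2 * p.+1`!%:R) * a j ^+ p.+1
    <= F 0%N - F k + Lp / nu0 / p.+1`!%:R * (Num.min (nu k) nu_max - nu0).
Proof.
elim: k => [|k IH] kM.
  rewrite big_ord0 subrr add0r nuO (min_l offar_nu_max_ge) subrr mulr0 //.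
rewrite big_ord_recr /=; apply: le_trans (lerD (IH (ltnW kM)) (lexx _)) _.
have dec := decrease k kM.
have A0 : 0 <= a k ^+ p.+1 by rewrite exprn_ge0 ?a_ge0.
have s0 := offar_sigma_gt0 k kM.
have nk0 := offar_nu_gt0 k (ltnW kM).
have nkS : nu k <= nu k.+1 by rewrite nuS // lerDl mulr_ge0 // ltW.
have c0 : 0 <= Lp / nu0 / p.+1`!%:R by rewrite !divr_ge0 ?ler0n // ltW.
have half : sigma k / (2 * p.+1`!%:R) = sigma k / p.+1`!%:R / 2.
  by rewrite invfM [2^-1 * _]mulrC mulrA.
have sA : 0 <= sigma k / p.+1`!%:R * a k ^+ p.+1.
  by rewrite mulr_ge0 // divr_ge0 ?ler0n // ltW.
rewrite mulrBl in dec; rewrite half.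
have [small|big] := leP (nu k) (2 * Lp / vtheta).
  have nmax := offar_nuS_le_max k kM small.
  rewrite (min_l (le_trans nkS nmax)) (min_l nmax) nuS //.
  have : Lp / p.+1`!%:R * a k ^+ p.+1
      <= Lp / nu0 / p.+1`!%:R * (nu k * a k ^+ p.+1).
    rewrite mulrA ler_wpM2r // mulrAC ler_wpM2r ?invr_ge0 ?ler0n //.
    by rewrite mulrAC ler_pdivlMr // ler_wpM2l // offar_nu_ge // ltnW.
  nra.
(* Truncating at [nu_max] lets one induction cover both phases: here the truncated [nu] need only be
   nondecreasing, however large [nu] becomes. *)
have mono : Num.min (nu k) nu_max <= Num.min (nu k.+1) nu_max.
  by rewrite le_min !ge_min nkS lexx !orbT.
have s2 : 2 * Lp <= sigma k.
  have /andP[+ _] := offar_sigma_range k kM; apply: le_trans.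
  by rewrite ltr_pdivrMr // in big; rewrite [leRHS]mulrC ltW.
have LA : Lp / p.+1`!%:R * a k ^+ p.+1 <= sigma k / p.+1`!%:R / 2 * a k ^+ p.+1.
  rewrite ler_wpM2r // mulrAC ler_wpM2r ?invr_ge0 ?ler0n // ler_pdivlMr //.
  by rewrite mulrC.
have := ler_wpM2l c0 mono; nra.
Qed.

Lemma offar_total k : (k <= M.+1)%N ->
  \sum_(j < k) sigma j / (2 * p.+1`!%:R) * a j ^+ p.+1 <= gap.
Proof.
move=> kM; apply: le_trans (offar_potential k kM) _; apply: le_trans gap_ge.
apply: lerD; first by rewrite lerD2l lerN2.
rewrite mulrC mulrA mulrC ler_wpM2l ?invr_ge0 ?ler0n // mulrC.
apply: (@le_trans _ _ (Lp / nu0 * nu_max)).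
  by rewrite ler_wpM2l ?divr_ge0 ?(ltW nu0_gt0) // lerBlDr ge_min lerDl (ltW nu0_gt0) orbT.
by rewrite lerDl mulr_ge0 // ltW.
Qed.

(** Since [nu j] is at most [sigma j / vtheta], each increment of [nu] is a fixed multiple at most
    of the summand in [offar_total]. *)
Lemma offar_nu_le k : (k <= M.+1)%N -> nu k <= sigma_max.
Proof.
move=> kM; have total := offar_total k kM.
apply: le_trans sigma_max_gap.
apply: (@le_trans _ _ (2 * p.+1`!%:R / vtheta *
    (\sum_(j < k) sigma j / (2 * p.+1`!%:R) * a j ^+ p.+1) + nu0)); last first.
  rewrite lerD ?offar_nu_max_ge // ler_wpM2l //.
  by rewrite divr_ge0 ?mulr_ge0 ?ler0n // ltW.
elim: k kM {total} => [|k IH] kM; first by rewrite big_ord0 mulr0 add0r nuO.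
rewrite nuS // big_ord_recr mulrDr /= addrAC.
apply: lerD; first exact: IH (ltnW kM).
rewrite mulrA ler_wpM2r ?exprn_ge0 ?a_ge0 //.
have -> : 2 * p.+1`!%:R / vtheta * (sigma k / (2 * p.+1`!%:R)) = sigma k / vtheta.
  by field; rewrite !gt_eqF ?fact_gt0R.
by rewrite ler_pdivlMr // mulrC; have /andP[] := offar_sigma_range k kM.
Qed.

Lemma offar_sigma_le k : (k <= M)%N -> sigma k <= sigma_max.
Proof.
move=> kM; have /andP[_ le] := offar_sigma_range k kM.
by apply: le_trans le _; rewrite ge_max sigma_max_Lp offar_nu_le // ltnW.
Qed.

(** Step [k] is bounded below through the gradient at its end point, [eps < g k.+1], hence the
    strict [k < M]. The power [(p+1)/p] turns [a k ^+ p] into [a k ^+ p.+1]. *)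
Lemma offar_step_count k : (k < M)%N ->
  1 <= sigma k / (2 * p.+1`!%:R) * a k ^+ p.+1 *
    (2 * p.+1`!%:R * sigma_max `^ (p%:R^-1)
     * ((vtheta * p`!%:R)^-1 * (Lp / nu0 + vtheta * theta1)) `^ (p.+1%:R / p%:R)
     * eps `^ (- (p.+1%:R / p%:R))).
Proof.
move=> kM; have kM' := ltnW kM.
have p0R : 0 < p%:R :> R by rewrite ltr0n.
have pn0 : p%:R != 0 :> R by rewrite gt_eqF.
set e := p.+1%:R / p%:R.
have e0 : 0 <= e by rewrite divr_ge0 ?ler0n.
set W := _^-1 * _.
have W0 : 0 <= W.
  rewrite mulr_ge0 ?invr_ge0 ?mulr_ge0 ?ler0n ?(ltW vtheta_gt0) // addr_ge0 //.
    by rewrite divr_ge0 // ltW.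
  by rewrite mulr_ge0 ?ltW.
have s0 := offar_sigma_gt0 k kM'.
have epsW : eps <= sigma k * W * a k ^+ p.
  rewrite -(ler_pM2l (fact_gt0R p)).
  apply: le_trans (ler_wpM2l (ltW (fact_gt0R p)) (ltW (g_gt _ kM))) _.
  apply: le_trans (grad_le k kM) _.
  rewrite mulrA ler_wpM2r ?exprn_ge0 ?a_ge0 //.
  (* [Lp] is absorbed into a multiple of [sigma k] by [vtheta * nu0 <= sigma k]. *)
  have -> : p`!%:R * (sigma k * W) = sigma k * (Lp / (vtheta * nu0) + theta1).
    by rewrite /W; field; rewrite !gt_eqF ?fact_gt0R.
  rewrite mulrDr [theta1 * _]mulrC lerD2r mulrCA -[leLHS]mulr1 ler_wpM2l //.
  by rewrite ler_pdivlMr ?mulr_gt0 // mul1r offar_sigma_ge.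
have epsE : eps `^ e <= sigma k * sigma_max `^ (p%:R^-1) * W `^ e * a k ^+ p.+1.
  apply: le_trans (ge0_ler_powR e0 _ _ epsW) _; rewrite ?nnegrE ?(ltW eps_gt0) //.
    by rewrite mulr_ge0 ?exprn_ge0 ?a_ge0 // mulr_ge0 // ltW.
  rewrite (powRM _ (mulr_ge0 (ltW s0) W0) (exprn_ge0 _ (a_ge0 k kM'))).
  rewrite (powRM _ (ltW s0) W0).
  have -> : (a k ^+ p) `^ e = a k ^+ p.+1.
    by rewrite -powR_mulrn ?a_ge0 // -powRrM mulrC divfK // powR_mulrn ?a_ge0.
  rewrite ler_wpM2r ?exprn_ge0 ?a_ge0 // ler_wpM2r ?powR_ge0 //.
  (* One full factor [sigma k] is kept for the summand; only the remaining power [1/p] is replaced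
     by that of [sigma_max]. *)
  have -> : e = 1 + p%:R^-1 by rewrite /e -[p.+1]add1n natrD mulrDl mul1r divff // addrC.
  rewrite powRD ?(gt_eqF s0) ?implybT // powRr1 ?(ltW s0) // ler_wpM2l ?(ltW s0) //.
  rewrite ge0_ler_powR ?invr_ge0 ?ler0n ?nnegrE ?(ltW s0) ?offar_sigma_le //.
  exact: le_trans (ltW s0) (offar_sigma_le k kM').
rewrite powRN.
have eps0 : 0 < eps `^ e by rewrite powR_gt0.
rewrite mulrA ler_pdivlMr // mul1r; apply: le_trans epsE _.
rewrite le_eqVlt; apply/orP; left; apply/eqP; field.
by rewrite gt_eqF ?fact_gt0R.
Qed.

Lemma offar_count :
  M%:R <= 2 * p.+1`!%:R * sigma_max `^ (p%:R^-1)
     * ((vtheta * p`!%:R)^-1 * (Lp / nu0 + vtheta * theta1)) `^ (p.+1%:R / p%:R)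
     * gap * eps `^ (- (p.+1%:R / p%:R)).
Proof.
set K := 2 * _ * _ * _; rewrite mulrAC; set E := K * _.
have E0 : 0 <= E by rewrite !mulr_ge0 ?powR_ge0 ?ler0n.
apply: le_trans (ler_wpM2l E0 (offar_total M (leqnSn M))).
rewrite mulr_sumr -[M in M%:R]card_ord -sumr_const; apply: ler_sum => j _.
by rewrite mulrC; exact: offar_step_count.
Qed.

End Counting.

(** * The algorithm *)

Lemma taylor0 (R : realType) (n p : nat) (f : 'rV[R]_n -> R) (x : 'rV[R]_n) :
  Cp p f -> taylor f p x 0 = f x.
Proof.
move=> f_Cp; rewrite /taylor big_nat big1 ?addr0 // => i /andP[i1 ip].
case: i i1 ip => // i _ ip.
suff e : iter_diff f (nseq i.+1 0) x = 0 by rewrite [tapply _ _]e mulr0.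
apply: (multilinear0 R n i.+1 (fun vs => iter_diff f vs x) [::]).
  exact: (iter_diff_multilinear R n p).
by rewrite /= size_nseq.
Qed.

Section Run.
Variables (R : realType) (n p : nat) (f : 'rV[R]_n -> R) (f_low Lp kappa : R).
Variables (x0 : 'rV[R]_n) (nu0 eps theta1 vtheta : R).
Variables (x s : nat -> 'rV[R]_n) (sigma nu : nat -> R).
Hypotheses (p_gt0 : (0 < p)%N) (f_Cp : Cp p f) (Lp_ge0 : 0 <= Lp).
Hypothesis f_bounded : forall y, f_low <= f y.
Hypothesis f_Lipschitz : forall y z : 'rV[R]_n,
  tnorm (fun vs : p.-tuple 'rV[R]_n => nabla f y vs - nabla f z vs)
    <= Lp * enorm (y - z).
Hypothesis f_high : forall (y : 'rV[R]_n) (i : nat), (2 <= i <= p)%N ->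
  forall d : 'rV[R]_n, enorm d <= 1 -> kappa <= tapply (nabla (i := i) f y) d.
Hypotheses (nu0_gt0 : 0 < nu0) (eps_gt0 : 0 < eps) (theta1_gt0 : 0 < theta1).
Hypotheses (vtheta_gt0 : 0 < vtheta) (vtheta_le1 : vtheta <= 1).
Hypothesis run : offar_run p f x0 nu0 eps theta1 vtheta x s sigma nu.

Lemma run_model_decrease k : offar_active f eps x k ->
  sigma k / p.+1`!%:R * enorm (s k) ^+ p.+1 < f (x k) - taylor f p (x k) (s k).
Proof.
move=> act; have := run_decrease run act.
rewrite /model (taylor0 _ _ _ _ _ f_Cp) enorm0 expr0n mulr0 addr0.
by rewrite subr_lt0 ltrBrDl.
Qed.

Lemma run_enorm_step_gt0 k : offar_active f eps x k -> 0 < enorm (s k).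
Proof.
move=> act; rewrite lt_def enorm_ge0 andbT; apply/eqP => s0.
have := run_model_decrease k act.
by rewrite s0 (enorm_eq0 _ _ _ s0) (taylor0 _ _ _ _ _ f_Cp) expr0n mulr0 subrr ltxx.
Qed.

(** Adds the Taylor error of the gradient to the inexact stationarity of the step. *)
Lemma run_gradient_le k : offar_active f eps x k ->
  p`!%:R * enorm (grad f (x k.+1)) <= (Lp + theta1 * sigma k) * enorm (s k) ^+ p.
Proof.
move=> act; rewrite (run_xS run act).
have fp : 0 < p`!%:R :> R by rewrite ltr0n fact_gt0.
rewrite -ler_pdivlMl //.
apply: le_trans (enorm_grad_step_le R n p f f_Cp Lp Lp_ge0 f_Lipschitz _ _ p_gt0) _.
rewrite mulrDl mulrDr [in leRHS]mulrC lerD2l.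
apply: le_trans (run_stationary run act) _.
by rewrite le_eqVlt; apply/orP; left; apply/eqP; ring.
Qed.

Lemma run_count M : offar_active f eps x M ->
  M%:R <= offar_kappa p f x0 f_low Lp kappa nu0 theta1 vtheta nu0
     * offar_gap p f x0 f_low Lp kappa nu0 theta1 vtheta nu0
     * eps `^ (- (p.+1%:R / p%:R)).
Proof.
move=> actM.
have act k : (k <= M)%N -> offar_active f eps x k.
  by move=> kM j jk; apply: actM; exact: leq_trans jk kM.
have x00 := run_x0 run.
apply: (@offar_count R p Lp kappa nu0 theta1 vtheta f_low eps (fun k => f (x k))
  (fun k => enorm (s k)) (fun k => enorm (grad f (x k))) sigma nu M _ _ _ _ _ _ _ _ _ _
  _ _ _ _ _ _ _ (offar_nu_max p f x0 Lp kappa nu0 theta1 vtheta nu0)).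
- exact: p_gt0.
- exact: Lp_ge0.
- exact: nu0_gt0.
- exact: theta1_gt0.
- exact: vtheta_gt0.
- exact: vtheta_le1.
- exact: eps_gt0.
- exact: (run_nu0 run).
- exact: (run_sigma0 run).
- by move=> k; exact: f_bounded.
- by move=> k kM; apply: actM.
- by move=> k kM; apply: run_enorm_step_gt0; exact: act.
- by move=> k kM; exact: (run_nuS run (act k kM)).
- move=> k kM; have /andP[-> /= le] := run_sigmaS run (act k.+1 kM).
  apply: le_trans le _; rewrite ge_max le_max lexx /= le_max; apply/orP; right.
  have ak := act k (ltnW kM).
  (* Divided by the [p]-th power of the step length, the gradient bound says that [offar_muS] is at
     most [Lp]. *)
  rewrite /offar_muS lerBlDr ler_pdivrMr ?exprn_gt0 ?run_enorm_step_gt0 //.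
  exact: run_gradient_le.
- move=> k kM; rewrite (run_xS run (act k kM)).
  have arith (X Y Z b l c w : R) : b / c * w < Y - Z -> X - Z <= l * w / c ->
      X <= Y - (b - l) / c * w.
    have -> : (b - l) / c * w = b / c * w - l * w / c by ring.
    lra.
  apply: (arith _ _ _ _ _ _ _ (run_model_decrease k (act k kM))).
  exact: (taylor_value_bound R n p f f_Cp Lp f_Lipschitz).
- by move=> k kM; exact: (run_gradient_le _ (act k (ltnW kM))).
- move=> k kM sk.
  apply: offar_step_le => //; first by apply: run_enorm_step_gt0; exact: act.
    exact: enorm_ge0.
  apply: le_trans (ltW (run_model_decrease k (act k kM))) _.
  apply: taylor_decrease_le => //.
  by move=> i ip d; apply: f_high.
- by rewrite x00 le_max lexx.
- by rewrite le_max lexx orbT.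
- by rewrite x00.
- by rewrite !le_max lexx.
- by rewrite !le_max lexx orbT.
Qed.

Lemma offar_gap_ge0 : 0 <= offar_gap p f x0 f_low Lp kappa nu0 theta1 vtheta nu0.
Proof.
have eta0 : 0 <= offar_eta p kappa nu0 vtheta.
  by apply: sumr_ge0 => i _; exact: powR_ge0.
have max0 : 0 <= offar_nu_max p f x0 Lp kappa nu0 theta1 vtheta nu0.
  rewrite le_max addr_ge0 ?(ltW nu0_gt0) // mulr_ge0 ?(ltW nu0_gt0) // exprn_ge0 //.
  by rewrite addr_ge0 ?mulr_ge0 ?powR_ge0.
rewrite addr_ge0 ?subr_ge0 // mulr_ge0 ?invr_ge0 ?ler0n // addr_ge0 //.
  by rewrite mulr_ge0 // divr_ge0 // ltW.
by rewrite mulr_ge0 // ltW.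
Qed.

Lemma offar_bound_ge :
  offar_kappa p f x0 f_low Lp kappa nu0 theta1 vtheta nu0
     * offar_gap p f x0 f_low Lp kappa nu0 theta1 vtheta nu0
     * eps `^ (- (p.+1%:R / p%:R)) + 2
  <= offar_bound p f x0 f_low Lp kappa nu0 eps theta1 vtheta nu0.
Proof. by rewrite /offar_bound lerD2r mulrDl lerDl mulr_ge0 ?powR_ge0. Qed.

Lemma offar_kappa_gap_ge0 :
  0 <= offar_kappa p f x0 f_low Lp kappa nu0 theta1 vtheta nu0
     * offar_gap p f x0 f_low Lp kappa nu0 theta1 vtheta nu0
     * eps `^ (- (p.+1%:R / p%:R)).
Proof.
by rewrite !mulr_ge0 ?offar_gap_ge0 ?powR_ge0 ?ler0n.
Qed.
End Run.

(* K is the index at which the algorithm stops: it has then entered iterations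
   0, .., K, and evaluated derivatives of f at x_0, .., x_K. *)
Theorem theorem3p10 (R : realType) (n p : nat) (f : 'rV[R]_n -> R)
    (f_low Lp kappa_high : R)
    (x0 : 'rV[R]_n) (nu0 eps1 theta1 vtheta : R)
    (x s : nat -> 'rV[R]_n) (sigma nu : nat -> R)
    (n_ge1 : (1 <= n)%N) (p_ge1 : (1 <= p)%N)
    (f_Cp : Cp p f)
    (f_bounded : forall y, f_low <= f y)
    (Lp_ge0 : 0 <= Lp)
    (f_Lipschitz : forall y z : 'rV[R]_n,
      tnorm (fun vs : p.-tuple 'rV[R]_n => nabla f y vs - nabla f z vs)
        <= Lp * enorm (y - z))
    (kappa_high_le0 : kappa_high <= 0)
    (kappa_high_p1 : p = 1%N -> kappa_high = 0)
    (f_high : forall (y : 'rV[R]_n) (i : nat), (2 <= i <= p)%N ->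
      forall d : 'rV[R]_n, enorm d <= 1 ->
        kappa_high <= tapply (nabla (i := i) f y) d)
    (nu0_gt0 : 0 < nu0) (eps1_range : 0 < eps1 <= 1)
    (theta1_gt1 : 1 < theta1) (vtheta_range : 0 < vtheta <= 1)
    (run : offar_run p f x0 nu0 eps1 theta1 vtheta x s sigma nu) :
  exists K : nat,
    [/\ forall j, (j < K)%N -> eps1 < enorm (grad f (x j)),
        enorm (grad f (x K)) <= eps1
      & K.+1%:R <= offar_bound p f x0 f_low Lp kappa_high nu0 eps1
                     theta1 vtheta (sigma 0%N)].
Proof.
case/andP: eps1_range => eps_gt0 _; case/andP: vtheta_range => v_gt0 v_le1.
have th_gt0 : 0 < theta1 := lt_trans ltr01 theta1_gt1.
have count := run_count _ _ _ _ _ _ _ _ _ _ _ _ _ _ _ _ p_ge1 f_Cp Lp_ge0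
  f_bounded f_Lipschitz f_high nu0_gt0 eps_gt0 th_gt0 v_gt0 v_le1 run.
rewrite (run_sigma0 run).
have bound2 := offar_bound_ge R n p f f_low Lp kappa_high x0 nu0 eps1 theta1 vtheta.
have A0 := offar_kappa_gap_ge0 R n p f f_low Lp kappa_high x0 nu0 eps1 theta1 vtheta
  Lp_ge0 f_bounded nu0_gt0 v_gt0.
set B := offar_bound _ _ _ _ _ _ _ _ _ _ _ in bound2 *.
set A := _ * _ * _ in count bound2 A0.
(* Otherwise every iteration is active, and [count] fails at the integer [Num.bound A], which
   exceeds [A]. *)
have stops : exists j, enorm (grad f (x j)) <= eps1.
  apply/not_existsP => never.
  have /count : offar_active f eps1 x (Num.bound A).
    by move=> j _; rewrite ltNge; apply/negP.
  rewrite leNgt => /negP; apply; exact: archi_boundP.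
have [K stop minK] := ex_minnP stops.
have active j : (j < K)%N -> eps1 < enorm (grad f (x j)).
  by move=> jK; rewrite ltNge; apply: contraL jK => /minK; rewrite -leqNgt.
exists K; split => //; apply: le_trans bound2.
(* For a positive stopping index, [count] applies to its predecessor, two less than the number to
   bound, whence the [+ 2]. For index 0 the number is 1, and [A] is nonnegative. *)
case: K {stop minK} active => [|K] active; last first.
  by rewrite -addn2 natrD lerD2r; apply: count => j jK; exact: active.
by rewrite (le_trans (ler1n _ 2)) // lerDr.
Qed.
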